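(* For $i=1,2$ let $S^{(i)}$ be $\mathrm{GH}(d,\lambda^{(i)},\alpha^{(i)},\beta^{(i)},\delta^{(i)},\mu^{(i)})$ distributed with matrix $\Delta^{(i)}$. If $$\lambda^{(1)}\le\lambda^{(2)},\qquad\delta^{(1)}\le\delta^{(2)},\qquad\alpha^{(1)}\ge\alpha^{(2)},\qquad\mu^{(1)}\le\mu^{(2)}$$ and one of the following three cases holds: (a) $0\le\beta^{(1)}\le\beta^{(2)}$ and $\Delta^{(i)}=I$ for $i=1,2$; (b) $\beta^{(i)}=0$ for $i=1,2$ and $\Delta^{(1)}\le_{\mathrm{psd}}\Delta^{(2)}$; (c) $0\le\beta^{(1)}\le\beta^{(2)}$, $\Delta^{(1)}\le_{\mathrm{psd}}\Delta^{(2)}$ and $0\le\Delta^{(1)}_{kl}\le\Delta^{(2)}_{kl}$ for all $k,l\le d$; then $S^{(1)}\le_{\mathrm{icx}}S^{(2)}$.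
   Context: A $d$-dimensional generalized hyperbolic random vector $S\sim\mathrm{GH}(d,\lambda,\alpha,\beta,\delta,\mu)$ with matrix $\Delta$ is one with the mixing representation $S=\mu+X\Delta\beta+\sqrt X\,N$, where $\mu,\beta\in\mathbb R^d$, $\Delta$ is a symmetric positive semidefinite real $d\times d$ matrix with $\det\Delta=1$, $N\sim\mathcal N(0,\Delta)$, and $X$ is independent of $N$ and generalized inverse Gaussian distributed with density $$d_{\mathrm{GIG}(\lambda,\delta,\gamma)}(x)=\Big(\frac\gamma\delta\Big)^\lambda\frac1{2K_\lambda(\delta\gamma)}\,x^{\lambda-1}e^{-\frac12(\delta^2/x+\gamma^2x)}\,\mathbf 1_{\mathbb R_+}(x),$$ with $\delta\ge0$, $\alpha>0$, $\alpha^2>\beta\Delta\beta^T$ and $\gamma=\sqrt{\alpha^2-\beta\Delta\beta^T}$; $K_\lambda$ is the modified Bessel function of the third kind with index $\lambda$. Vector inequalities are componentwise; $I$ is the identity matrix; $A\le_{\mathrm{psd}}B$ means $B-A$ is positive semidefinite. $X\le_{\mathrm{icx}}Y$ means $Ef(X)\le Ef(Y)$ for all (componentwise) nondecreasing convex $f:\mathbb R^d\to\mathbb R$ such that $f(X),f(Y)$ are integrable. *)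

(* Defs.v *)
From HB Require Import structures.
From mathcomp Require Import all_boot all_order all_algebra.
From mathcomp Require Import all_classical all_reals all_analysis.

Set Implicit Arguments.
Unset Strict Implicit.
Unset Printing Implicit Defensive.

Import Order.TTheory GRing.Theory Num.Theory.
Import numFieldNormedType.Exports.

Local Open Scope classical_set_scope.
Local Open Scope ring_scope.

(* R^n is the type of row vectors; its sigma-algebra is the one generated by
   the coordinate projections, i.e. the Borel sigma-algebra. *)
Section measurable_rV.
Variables (R : realType) (n : nat).

Definition rV_coord (i : 'I_n) (x : 'rV[R]_n) : R := x ord0 i.

Let rV_set0 : g_sigma_preimage rV_coord set0.
Proof. exact: sigma_algebra0. Qed.

Let rV_setC A :
  g_sigma_preimage rV_coord A -> g_sigma_preimage rV_coord (~` A).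
Proof. exact: sigma_algebraC. Qed.

Let rV_bigcup (F : _^nat) : (forall i, g_sigma_preimage rV_coord (F i)) ->
  g_sigma_preimage rV_coord (\bigcup_i (F i)).
Proof. exact: sigma_algebra_bigcup. Qed.

HB.instance Definition _ := @isMeasurable.Build default_measure_display
  'rV[R]_n (g_sigma_preimage rV_coord) rV_set0 rV_setC rV_bigcup.

End measurable_rV.

Section linear_algebra.
Variables (R : realType) (n : nat).
Implicit Types (u v : 'rV[R]_n) (A B : 'M[R]_n).

Definition vec_le u v : Prop := forall i, u ord0 i <= v ord0 i.

Definition quad_form A v : R := (v *m A *m v^T) ord0 ord0.

Definition is_psd A : Prop := A^T = A /\ forall v, 0 <= quad_form A v.

Definition psd_le A B : Prop := is_psd (B - A).

End linear_algebra.

Section gig.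
Variable R : realType.
Implicit Types (lambda delta gamma x z : R).

(* Integral representation
   K_lambda(z) = 1/2 \int_0^oo u^(lambda-1) e^(-z/2 (u + 1/u)) du   (z > 0)
   of the modified Bessel function of the third kind. *)
Definition besselK lambda z : R :=
  2^-1 * Rintegral lebesgue_measure `]0, +oo[
    (fun u => u `^ (lambda - 1) * expR (- (z / 2) * (u + u^-1))).

Definition Gamma lambda : R :=
  Rintegral lebesgue_measure `]0, +oo[
    (fun u => u `^ (lambda - 1) * expR (- u)).

(* For delta = 0 the usual constant is meaningless and is replaced by its limit
   as delta -> 0+.  For lambda > 0 this gives the Gamma(lambda, gamma^2/2)
   density.  For lambda <= 0 the limit is 0, and so is the value below, because
   the integral defining [Gamma lambda] is infinite and [Rintegral] is then 0;
   hence no random variable has such a GIG(lambda, 0, gamma) density. *)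
Definition gig_const lambda delta gamma : R :=
  if delta == 0 then (gamma ^+ 2 / 2) `^ lambda / Gamma lambda
  else (gamma / delta) `^ lambda / (2 * besselK lambda (delta * gamma)).

Definition gig_pdf lambda delta gamma x : R :=
  if 0 < x then
    gig_const lambda delta gamma * x `^ (lambda - 1) *
    expR (- 2^-1 * (delta ^+ 2 / x + gamma ^+ 2 * x))
  else 0.

End gig.

Section distributions.
Variables (R : realType) (d : measure_display) (T : measurableType d).
Variable P : probability T R.

Definition same_law (n : nat) (d' : measure_display) (T' : measurableType d')
    (P' : probability T' R) (S : T -> 'rV[R]_n) (S' : T' -> 'rV[R]_n) : Prop :=
  forall A : set 'rV[R]_n, measurable A -> P (S @^-1` A) = P' (S' @^-1` A).

Definition is_gig (X : {RV P >-> R}) (lambda delta gamma : R) : Prop :=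
  forall A : set R, measurable A ->
    distribution P X A =
    (\int[lebesgue_measure]_(x in A) (gig_pdf lambda delta gamma x)%:E)%E.

Definition is_std_normal (n : nat) (Z : {RV P >-> 'rV[R]_n}) : Prop :=
  forall A : 'I_n -> set R, (forall i, measurable (A i)) ->
    P [set w | forall i, A i (Z w ord0 i)] =
    (\prod_(i < n) normal_prob 0 1 (A i))%E.

Definition independent_RV (n : nat) (X : {RV P >-> R})
    (N : {RV P >-> 'rV[R]_n}) : Prop :=
  forall (A : set R) (B : set 'rV[R]_n), measurable A -> measurable B ->
    P (X @^-1` A `&` N @^-1` B) = (P (X @^-1` A) * P (N @^-1` B))%E.

End distributions.

(* N(0, Delta) is the law of Delta^(1/2) Z, with Z standard normal and
   Delta^(1/2) the positive semidefinite square root of Delta; this covers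
   singular Delta as well. *)
Definition is_normal (R : realType) (d : measure_display)
    (T : measurableType d) (P : probability T R) (n : nat)
    (N : {RV P >-> 'rV[R]_n}) (Delta : 'M[R]_n) : Prop :=
  exists (Q : 'M[R]_n) (d' : measure_display) (T' : measurableType d')
    (P' : probability T' R) (Z : {RV P' >-> 'rV[R]_n}),
    [/\ is_psd Q, Q *m Q = Delta, is_std_normal Z &
        same_law P P' N (fun w => Z w *m Q)].

(* With row vectors and Delta symmetric, the vector Delta beta is
   [beta *m Delta]. *)
Definition is_GH (R : realType) (d : measure_display) (T : measurableType d)
    (P : probability T R) (n : nat) (S : {RV P >-> 'rV[R]_n})
    (lambda alpha : R) (beta : 'rV[R]_n) (delta : R) (mu : 'rV[R]_n)
    (Delta : 'M[R]_n) : Prop :=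
  [/\ is_psd Delta, \det Delta = 1, 0 <= delta, 0 < alpha &
      quad_form Delta beta < alpha ^+ 2] /\
  exists (d' : measure_display) (T' : measurableType d')
    (P' : probability T' R) (X : {RV P' >-> R}) (N : {RV P' >-> 'rV[R]_n}),
    [/\ is_gig X lambda delta (Num.sqrt (alpha ^+ 2 - quad_form Delta beta)),
        is_normal N Delta, independent_RV X N &
        same_law P P' S (fun w =>
          mu + X w *: (beta *m Delta) + Num.sqrt (X w) *: N w)].

Definition icx_le (R : realType) (n : nat)
    (d1 : measure_display) (T1 : measurableType d1) (P1 : probability T1 R)
    (d2 : measure_display) (T2 : measurableType d2) (P2 : probability T2 R)
    (X : {RV P1 >-> 'rV[R]_n}) (Y : {RV P2 >-> 'rV[R]_n}) : Prop :=
  forall f : 'rV[R]_n -> R,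
    (forall u v, vec_le u v -> f u <= f v) ->
    convex_function [set: 'rV[R]_n] f ->
    P1.-integrable [set: T1] (EFin \o (f \o X)) ->
    P2.-integrable [set: T2] (EFin \o (f \o Y)) ->
    ('E_P1[f \o X] <= 'E_P2[f \o Y])%E.

(* Main.v *)
Require Import Defs.
From HB Require Import structures.
From mathcomp Require Import all_boot all_order all_algebra.
From mathcomp Require Import all_classical all_reals all_analysis.
From mathcomp Require Import measurable_realfun ring lra.

Set Implicit Arguments.
Unset Strict Implicit.
Unset Printing Implicit Defensive.

Import Order.TTheory GRing.Theory Num.Theory.
Import numFieldNormedType.Exports.

Local Open Scope classical_set_scope.
Local Open Scope ring_scope.

(* Two positive definite matrices of determinant 1 that are comparable for the
   psd order are equal, so both mixtures are driven by the same normal law,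
   which is symmetric: E f(mu + X b + sqrt X N) is the expectation of
   phi(X, N), where
     phi(x, v) = (f(mu + x b + sqrt x v) + f(mu + x b - sqrt x v)) / 2.
   For fixed v, convexity and monotonicity of f make phi nondecreasing in
   x >= 0 and in (mu, b).  The ratio of the two GIG densities is nondecreasing,
   so they cross at most once, at some level c: the second law has more mass
   above c, where phi >= phi(c, v), and less below, where phi <= phi(c, v).
   This orders the expectations over X for fixed v, and Fubini concludes. *)

(** * Positive semidefinite matrices *)

Section psd.
Variable R : realType.

Let addmxE m n (A B : 'M[R]_(m, n)) i j : (A + B) i j = A i j + B i j.
Proof. by rewrite mxE. Qed.

Let mx0E m n i j : (0 : 'M[R]_(m, n)) i j = 0.
Proof. by rewrite mxE. Qed.

Let scalemxE m n a (A : 'M[R]_(m, n)) i j : (a *: A) i j = a * A i j.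
Proof. by rewrite mxE. Qed.

Let mulmx1E m n (A : 'M[R]_(m, 1)) (B : 'M[R]_(1, n)) i j :
  (A *m B) i j = A i 0 * B 0 j.
Proof. by rewrite mxE big_ord1. Qed.

Lemma quad_formD n (A B : 'M[R]_n) v :
  quad_form (A + B) v = quad_form A v + quad_form B v.
Proof. by rewrite /quad_form mulmxDr mulmxDl mxE. Qed.

Lemma quad_formN n (A : 'M[R]_n) v : quad_form (- A) v = - quad_form A v.
Proof. by rewrite /quad_form mulmxN mulNmx mxE. Qed.

Lemma quad_form_congr n (A Q : 'M[R]_n) v :
  quad_form (Q *m A *m Q^T) v = quad_form A (v *m Q).
Proof. by rewrite /quad_form trmx_mul !mulmxA. Qed.

Lemma quad_form0 n (A : 'M[R]_n) : quad_form A 0 = 0.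
Proof. by rewrite /quad_form !mul0mx mx0E. Qed.

Lemma quad_form1 n (v : 'rV[R]_n) : quad_form 1%:M v = \sum_i v ord0 i ^+ 2.
Proof.
rewrite /quad_form mulmx1 mxE; apply: eq_bigr => i _.
by rewrite mxE expr2.
Qed.

(** Along [t *: v + e] the form is affine in [t], because its quadratic coefficient [quad_form A v]
    is 0. Being nonnegative for every [t], it has slope 0, and the slope is twice a coordinate of
    [v *m A]. *)
Lemma psd_quad_form_eq0 n (A : 'M[R]_n) v :
  is_psd A -> quad_form A v = 0 -> v *m A = 0.
Proof.
move=> [symA A0] qv; apply/rowP => j; rewrite !mxE.
set e := (delta_mx 0 j : 'rV[R]_n).
have -> : \sum_k v 0 k * A k j = (v *m A *m e^T) 0 0.
  rewrite mxE [RHS](bigD1 j)//= [X in _ = _ + X]big1 => [|i ij].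
    by rewrite [e^T _ _]mxE [e _ _]mxE !eqxx mulr1 addr0 mxE.
  by rewrite [e^T _ _]mxE [e _ _]mxE eqxx (negbTE ij) mulr0.
set b := (v *m A *m e^T) 0 0.
have bE : (e *m A *m v^T) 0 0 = b.
  have -> : e *m A *m v^T = (v *m A *m e^T)^T.
    by rewrite !trmx_mul trmxK symA mulmxA.
  by rewrite mxE.
have qE t : quad_form A (t *: v + e) = t * (2 * b) + quad_form A e.
  have qv' : (v *m A *m v^T) 0 0 = 0 by exact: qv.
  rewrite /quad_form linearD /= linearZ /= !mulmxDl !mulmxDr -!scalemxAl -!scalemxAr.
  by rewrite !addmxE !scalemxE qv' bE -/b; ring.
apply/eqP; apply: contraT => b0.
(* At this value of [t] the affine function equals -1. *)
have := A0 (- ((quad_form A e + 1) / (2 * b)) *: v + e).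
rewrite qE mulNr divfK ?mulf_neq0//; lra.
Qed.

(** By symmetry the diagonal entries of [D *m D] are the squared norms of the rows of [D]. *)
Lemma symmetric_sqr_eq0 n (D : 'M[R]_n) : D^T = D -> D *m D = 0 -> D = 0.
Proof.
move=> symD DD; apply/row_matrixP => i; rewrite row0.
have /eqP : quad_form 1%:M (row i D) = 0.
  transitivity ((D *m D) i i); last by rewrite DD mxE.
  rewrite quad_form1 mxE; apply: eq_bigr => k _.
  by rewrite -[in X in _ = _ * X]symD !mxE expr2.
rewrite quad_form1 psumr_eq0 => [/allP v0|j _]; last by rewrite sqr_ge0.
apply/rowP => j; have := v0 j (mem_index_enum j).
by rewrite /= sqrf_eq0 => /eqP ->; rewrite mxE.
Qed.

(** Makes the law described by [is_normal] depend on [Delta] alone, whichever root [Q] witnesses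
    it. *)
Lemma psd_sqrt_unique n (A B : 'M[R]_n) :
  is_psd A -> is_psd B -> A *m A = B *m B -> A = B.
Proof.
move=> Apsd Bpsd AB; pose D := A - B.
have symD : D^T = D by rewrite /D linearB /= Apsd.1 Bpsd.1.
have trE (M : 'M[R]_n) : \tr (D *m M *m D) = \sum_i quad_form M (row i D).
  apply: eq_bigr => i _; rewrite /quad_form -[in X in (_ *m X) i i]symD.
  by rewrite -!row_mul !mxE; apply: eq_bigr => k _; rewrite !mxE.
(* [A D + D B = A^2 - B^2 = 0], while both traces below are nonnegative. *)
have : \tr (D *m A *m D) + \tr (D *m B *m D) = 0.
  have -> : \tr (D *m B *m D) = \tr (D *m (D *m B)) by rewrite mxtrace_mulC.
  rewrite -mulmxA -raddfD /= -mulmxDr.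
  have -> : A *m D + D *m B = 0.
    rewrite /D mulmxBr mulmxBl AB; apply/eqP.
    by rewrite addrC subrKA subrr.
  by rewrite mulmx0 mxtrace0.
rewrite !trE => /eqP; rewrite paddr_eq0; last 2 first.
- by apply: sumr_ge0 => i _; exact: Apsd.2.
- by apply: sumr_ge0 => i _; exact: Bpsd.2.
have mul0 (M : 'M[R]_n) : is_psd M ->
    \sum_i quad_form M (row i D) == 0 -> D *m M = 0.
  move=> Mpsd; rewrite psumr_eq0 => [/allP M0|i _]; last exact: Mpsd.2.
  apply/row_matrixP => i; rewrite row_mul row0.
  apply: psd_quad_form_eq0 => //; apply/eqP.
  by apply: (implyP (M0 i _)) => //; rewrite mem_index_enum.
move=> /andP[/mul0-/(_ Apsd) DA /mul0-/(_ Bpsd) DB].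
have DD : D *m D = 0 by rewrite {2}/D mulmxBr DA DB subrr.
by apply/eqP; rewrite -subr_eq0; apply/eqP/symmetric_sqr_eq0.
Qed.

Lemma quad_form_row_mx n (a : 'M[R]_1) (v : 'rV[R]_n) (M : 'M[R]_n) y w :
  quad_form (block_mx a v v^T M : 'M[R]_(1 + n)) (row_mx y w) =
  a 0 0 * y 0 0 ^+ 2 + 2 * y 0 0 * (v *m w^T) 0 0 + quad_form M w.
Proof.
rewrite /quad_form mul_row_block tr_row_mx mul_row_col !mulmxDl.
have -> : w *m v^T *m y^T = (y *m (v *m w^T))^T by rewrite !trmx_mul trmxK.
rewrite -[y *m v *m _]mulmxA; set p := v *m w^T.
rewrite !addmxE -/(quad_form M w) [(y *m p)^T _ _]mxE !mulmx1E [y^T _ _]mxE.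
ring.
Qed.

Lemma quad_form1_row_mx n (y : 'rV[R]_1) (w : 'rV[R]_n) :
  quad_form (1%:M : 'M[R]_(1 + n)) (row_mx y w) =
  y 0 0 ^+ 2 + quad_form 1%:M w.
Proof.
rewrite scalar_mx_block -[X in block_mx _ _ X _]trmx0 quad_form_row_mx.
by rewrite mul0mx mx0E mulr0 addr0 [1%:M _ _]mxE mul1r.
Qed.

(** Induction on the dimension: the determinant is the corner entry times the determinant of its
    Schur complement, and both factors are at least 1. A product equal to 1 forces both to be 1. *)
Lemma det_psd_le1 n (M : 'M[R]_n) : psd_le 1%:M M ->
  1 <= \det M /\ (\det M = 1 -> M = 1%:M).
Proof.
elim: n M => [|n IHn] M.
  by rewrite det_mx00; split => // _; apply/matrixP => -[].
rewrite -[n.+1]/(1 + n)%N in M * => -[symM1 M1].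
have symM : M^T = M.
  by have := symM1; rewrite linearB /= trmx1 => /(@addIr _ _ _ _).
have {}M1 u : quad_form 1%:M u <= quad_form M u.
  by have := M1 u; rewrite quad_formD quad_formN subr_ge0.
rewrite -(submxK M) in symM M1 symM1 *.
move: symM1 symM M1.
move: (ulsubmx M) (ursubmx M) (dlsubmx M) (drsubmx M) => a v v' M' symM1.
rewrite tr_block_mx => /eq_block_mx[_ _ <- symM'] M1.
have M1' (y : 'rV[R]_1) (w : 'rV[R]_n) : y 0 0 ^+ 2 + quad_form 1%:M w <=
    a 0 0 * y 0 0 ^+ 2 + 2 * y 0 0 * (v *m w^T) 0 0 + quad_form M' w.
  rewrite -quad_form_row_mx; apply: le_trans (M1 (row_mx y w)).
  by rewrite quad_form1_row_mx.
have a1 : 1 <= a 0 0.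
  have := M1' 1%:M 0; rewrite trmx0 mulmx0 mx0E !quad_form0 [1%:M _ _]mxE /=.
  lra.
have a0 : a 0 0 != 0 by rewrite gt_eqF// (lt_le_trans ltr01).
(* The Schur complement of [a]; minimizing over the first coordinate shows that
   it also dominates the identity. *)
pose S := M' - (a 0 0)^-1 *: (v^T *m v).
have S1 : psd_le 1%:M S.
  split; first by rewrite /S !linearB /= linearZ /= trmx1 trmx_mul trmxK symM'.
  move=> w; rewrite quad_formD quad_formN subr_ge0.
  set p := (v *m w^T) 0 0.
  have := M1' (const_mx (- (a 0 0)^-1 * p)) w; rewrite -/p mxE.
  have -> : quad_form S w = quad_form M' w - (a 0 0)^-1 * p ^+ 2.
    rewrite quad_formD quad_formN; congr (_ - _).
    rewrite /quad_form -scalemxAr -scalemxAl scalemxE.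
    have -> : w *m (v^T *m v) *m w^T = (w *m v^T) *m (v *m w^T).
      by rewrite !mulmxA.
    rewrite mulmx1E.
    have -> : w *m v^T = (v *m w^T)^T by rewrite trmx_mul trmxK.
    by rewrite mxE -/p expr2.
  have -> : a 0 0 * (- (a 0 0)^-1 * p) ^+ 2 + 2 * (- (a 0 0)^-1 * p) * p =
            - ((a 0 0)^-1 * p ^+ 2) by field.
  move=> H; have := sqr_ge0 (- (a 0 0)^-1 * p); lra.
have [dS detS] := IHn S S1.
have detE : \det (block_mx a v v^T M') = a 0 0 * \det S.
  (* Block elimination of the column below [a], by a matrix of determinant 1. *)
  pose L : 'M[R]_(1 + n) := block_mx 1%:M 0 (- (a 0 0)^-1 *: v^T) 1%:M.
  have <- : \det (L *m block_mx a v v^T M') = \det (block_mx a v v^T M').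
    by rewrite det_mulmx det_lblock !det1 !mul1r.
  rewrite /L mulmx_block !mul1mx !mul0mx !addr0 -!scalemxAl.
  have -> : - (a 0 0)^-1 *: (v^T *m a) + v^T = 0.
    rewrite [a]mx11_scalar mul_mx_scalar scalerA mxE eqxx mulr1n mulNr mulVf//.
    by rewrite scaleN1r addNr.
  by rewrite det_ublock det_mx11 /S scaleNr addrC.
rewrite detE; split; first by rewrite -[leLHS]mulr1 ler_pM.
move=> aS; have a1E : a 0 0 = 1.
  have : a 0 0 * 1 <= a 0 0 * \det S by rewrite ler_pM2l// (lt_le_trans ltr01).
  by move=> ?; apply/eqP; rewrite eq_le a1 andbT; lra.
have SE : S = 1%:M by apply: detS; rewrite -aS a1E mul1r.
(* Since the corner entry is 1, the form of the block matrix minus the identity vanishes at the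
   first basis vector, so the first row of this difference is 0. *)
have v0 : v = 0.
  apply/rowP => j; rewrite mxE.
  have psd1 : is_psd (block_mx a v v^T M' - 1%:M).
    split=> [|u]; last by rewrite quad_formD quad_formN subr_ge0.
    by rewrite linearB /= trmx1 tr_block_mx trmxK symM' [a]mx11_scalar tr_scalar_mx.
  have := psd_quad_form_eq0 psd1 (v := row_mx 1%:M 0).
  have -> : quad_form (block_mx a v v^T M' - 1%:M) (row_mx 1%:M 0) = 0.
    rewrite quad_formD quad_formN quad_form1_row_mx quad_form_row_mx.
    by rewrite trmx0 mulmx0 mx0E !quad_form0 a1E [1%:M _ _]mxE /=; ring.
  move=> /(_ erefl)/matrixP/(_ 0 (rshift 1 j)).
  rewrite mulmxBr mulmx1 mul_row_block !mul0mx !mul1mx !addr0.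
  by rewrite opp_row_mx add_row_mx row_mxEr subr0 mx0E.
have aE : a = 1%:M by rewrite [a]mx11_scalar a1E.
move: SE; rewrite /S v0 mulmx0 scaler0 subr0 => ->.
by rewrite aE trmx0 -scalar_mx_block.
Qed.

(** Conjugation by the inverse of the root [Q] turns [A] into the identity and keeps both
    determinants equal to 1, which leads back to [det_psd_le1]. *)
Lemma psd_le_det1_eq n (A B : 'M[R]_n) : (exists2 Q, is_psd Q & Q *m Q = A) ->
  psd_le A B -> \det A = 1 -> \det B = 1 -> A = B.
Proof.
move=> [Q [symQ _] QA] [symAB AB] detA detB.
have Qunit : Q \in unitmx.
  rewrite unitmxE unitfE; apply/negP => /eqP Q0.
  by move: detA; rewrite -QA det_mulmx Q0 mulr0 => /eqP; rewrite eq_sym oner_eq0.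
pose P := invmx Q.
have symP : P^T = P by rewrite trmx_inv symQ.
have PAP : P *m A *m P = 1%:M by rewrite -QA mulKmx// mulmxV.
have le1 : psd_le 1%:M (P *m B *m P).
  rewrite -PAP; split=> [|v].
    rewrite -mulmxBl -mulmxBr !trmx_mul symP symAB mulmxA //.
  by rewrite -mulmxBl -mulmxBr -{2}symP quad_form_congr.
have detP : \det (P *m B *m P) = 1.
  by rewrite -[RHS](det1 R n) -PAP !det_mulmx detA detB.
have := (det_psd_le1 le1).2 detP; rewrite -PAP => /esym.
move=> /(congr1 (fun M => Q *m M *m Q)).
by rewrite !mulmxA mulmxV// !mul1mx -!mulmxA mulVmx// !mulmx1.
Qed.

End psd.

(** * Borel sets and convex functions on row vectors *)

Section measurable_rV_theory.
Variable R : realType.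

Lemma measurable_rV_coord n (i : 'I_n) :
  measurable_fun [set: 'rV[R]_n] (fun v : 'rV[R]_n => v ord0 i).
Proof.
move=> _ Y mY; rewrite setTI; apply: sub_sigma_algebra => /=.
rewrite -bigcup_seq/=; exists i => /=; first by rewrite mem_index_enum.
by exists Y => //; rewrite setTI.
Qed.

Lemma measurable_fun_rV d (T : measurableType d) n (g : T -> 'rV[R]_n) :
  (forall i, measurable_fun setT (fun t => g t ord0 i)) ->
  measurable_fun setT g.
Proof.
move=> mg; apply: (measurability
  (\big[setU/set0]_(i < n) preimage_set_system setT (@rV_coord R n i) measurable)).
  by [].
move=> _ [B + <-]; rewrite -bigcup_seq => -[i _ [C mC <-]].
by rewrite !setTI -comp_preimage -[X in measurable X]setTI; exact: mg.
Qed.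

Definition rV_box n (A : 'I_n -> set R) : set 'rV[R]_n :=
  [set v | forall i, A i (v ord0 i)].

Lemma measurable_rV_box n (A : 'I_n -> set R) :
  (forall i, measurable (A i)) -> measurable (rV_box A).
Proof.
move=> mA; have -> : rV_box A = \bigcap_(i in setT) ((fun v => v ord0 i) @^-1` A i).
  by apply/seteqP; split=> [v vA i _|v vA i]; exact: vA.
apply: fin_bigcap_measurable => // i _.
by rewrite -[X in measurable X]setTI; exact: measurable_rV_coord.
Qed.

(** Boxes are stable under intersection and generate the sigma-algebra, so they determine a
    probability. *)
Lemma rV_measure_eq n (m1 m2 : probability 'rV[R]_n R) :
  (forall A : 'I_n -> set R, (forall i, measurable (A i)) ->
    m1 (rV_box A) = m2 (rV_box A)) ->
  forall B, measurable B -> m1 B = m2 B.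
Proof.
move=> m12; apply: (measure_unique
  [set B | exists2 A : 'I_n -> set R, (forall i, measurable (A i)) & B = rV_box A]
  (fun=> setT)).
- apply/seteqP; split; last first.
    apply: smallest_sub; first exact: sigma_algebra_measurable.
    by move=> _ [A mA ->]; exact: measurable_rV_box.
  apply: smallest_sub; first exact: smallest_sigma_algebra.
  move=> B; rewrite -bigcup_seq => -[i _ [C mC <-]].
  (* A coordinate cylinder is a box whose other sides are full. *)
  apply: sub_sigma_algebra; exists (fun j => if j == i then C else setT).
    by move=> j; case: ifP.
  rewrite setTI; apply/seteqP; split=> [v Cv j|v /(_ i)] /=.
    by case: eqP => // ->.
  by rewrite eqxx.
- move=> _ _ [A mA ->] [A' mA' ->]; exists (fun i => A i `&` A' i).
    by move=> i; exact: measurableI.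
  by apply/seteqP; split=> [v [vA vA'] i|v vAA]; [split|split=> i; case: (vAA i)].
- move=> _; exists (fun=> setT) => //.
  by apply/seteqP; split.
- by apply/seteqP; split=> // v _; exists 0%N.
- by move=> _ [A mA ->]; exact: m12.
- by move=> _; rewrite (le_lt_trans (probability_le1 _ _))// ltry.
Qed.

Lemma measurable_fun_mulmx d (T : measurableType d) m n (g : T -> 'rV[R]_m)
    (Q : 'M[R]_(m, n)) :
  measurable_fun setT g -> measurable_fun setT (fun t => g t *m Q).
Proof.
move=> mg; apply: measurable_fun_rV => i.
rewrite (_ : (fun t => _) = fun t => \sum_j g t ord0 j * Q j i); last first.
  by apply/funext => t; rewrite mxE.
apply: measurable_sum => j; apply: measurable_funM => //.
exact: (measurableT_comp (measurable_rV_coord j)).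
Qed.

Lemma measurable_fun_oppmx d (T : measurableType d) n (g : T -> 'rV[R]_n) :
  measurable_fun setT g -> measurable_fun setT (fun t => - g t).
Proof.
move=> mg; apply: measurable_fun_rV => i.
rewrite (_ : (fun t => _) = fun t => - g t ord0 i); last first.
  by apply/funext => t; rewrite mxE.
apply: measurableT_comp => //.
exact: (measurableT_comp (measurable_rV_coord i)).
Qed.

End measurable_rV_theory.

(** * Measurability of nondecreasing convex functions *)

Section convex_monotone.
Variables (R : realType) (n : nat) (f : 'rV[R]_n -> R).
Hypothesis f_mono : forall u v, vec_le u v -> f u <= f v.
Hypothesis f_conv : convex_function [set: 'rV[R]_n] f.

Lemma convex_functionE (t : R) (u v : 'rV[R]_n) : 0 <= t -> t <= 1 ->
  f (t *: u + (1 - t) *: v) <= t * f u + (1 - t) * f v.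
Proof.
move=> t0 t1; have t01 : Itv.spec (@Itv.num_sem R) (Itv.Real `[0%Z, 1%Z]) t.
  by rewrite /= /Itv.num_sem /= num_real /= in_itv /= t0 t1.
have := @f_conv (Itv.mk t01) u v (mem_setT _) (mem_setT _).
by [].
Qed.

(** [icx_le] quantifies over [f] without a measurability condition, while the changes of variables
    below require one. *)
Lemma convex_mono_measurable : measurable_fun setT f.
Proof.
apply: (measurability _ (RGenInftyO.measurableE R)) => _ [_ [a ->] <-].
rewrite setTI.
have mbox (q : {ffun 'I_n -> rat}) :
    measurable (rV_box (fun i : 'I_n => `]-oo, (ratr (q i) : R)]%classic)).
  by apply: measurable_rV_box.
(* By monotonicity [f @^-1` `]-oo, a[] is a union of orthants with rational
   vertices; convexity along the diagonal makes [f] right continuous there. *)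
pose F (q : {ffun 'I_n -> rat}) : set 'rV[R]_n :=
  if f (\row_i ratr (q i)) < a then
    rV_box (fun i : 'I_n => `]-oo, (ratr (q i) : R)]%classic) else set0.
have -> : f @^-1` `]-oo, a[%classic = \bigcup_q F q.
  apply/seteqP; split=> [v|v [q _]]; rewrite /= in_itv /=; last first.
    rewrite /F; case: ifPn => // fq vq; apply: le_lt_trans fq.
    by apply: f_mono => i; rewrite mxE; have := vq i; rewrite /= in_itv.
  move=> fva.
  pose w : 'rV[R]_n := v + const_mx 1.
  have [e [e0 e1 fe]] : exists e, [/\ 0 < e, e <= 1 & f (e *: w + (1 - e) *: v) < a].
    have [fwa|fwa] := ltP (f w) a.
      by exists 1; rewrite subrr scale0r addr0 scale1r.
    (* Here [a <= f w], so [e <= 1]; the factor 1/2 brings the convexity bound to the midpoint of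
       [f v] and [a]. *)
    pose e := (a - f v) / (f w - f v) / 2.
    have d0 : 0 < f w - f v by lra.
    have e0 : 0 < e by rewrite /e !divr_gt0//; lra.
    have eE : e * (f w - f v) = (a - f v) / 2 by rewrite /e mulrAC divfK// gt_eqF.
    have e1 : e <= 1.
      rewrite -(ler_pM2r d0) eE mul1r; lra.
    exists e; split => //; apply: le_lt_trans (convex_functionE _ _ (ltW e0) e1) _.
    have -> : e * f w + (1 - e) * f v = e * (f w - f v) + f v by ring.
    rewrite eE; lra.
  have wE i : (e *: w + (1 - e) *: v) ord0 i = v ord0 i + e.
    by rewrite !mxE; ring.
  have /choice[q qP] : forall i : 'I_n, exists q : rat,
      v ord0 i <= ratr q /\ ratr q <= v ord0 i + e.
    move=> i; have : v ord0 i < v ord0 i + e by rewrite ltrDl.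
    by move=> /rat_in_itvoo[q]; rewrite in_itv /= => /andP[/ltW ? /ltW ?]; exists q.
  exists [ffun i => q i] => //; rewrite /F ifT.
    by move=> i /=; rewrite in_itv /= ffunE; case: (qP i).
  apply: le_lt_trans fe; apply: f_mono => i; rewrite wE mxE ffunE.
  by case: (qP i).
apply: countable_bigcupT_measurable => // q.
by rewrite /F; case: ifP.
Qed.

End convex_monotone.

(** * Normal laws *)

Section normal_law.
Variable R : realType.

(** The standard normal density is even and Lebesgue measure is invariant under reflection. *)
Lemma normal_prob01N (A : set R) : measurable A ->
  normal_prob 0 1 (-%R @^-1` A) = normal_prob 0 1 A :> \bar R.
Proof.
move=> mA; rewrite /normal_prob.
have mf : measurable_fun [set: R] (fun x : R => (normal_pdf 0 1 x)%:E).
  by apply/measurable_EFinP; exact: measurable_normal_pdf.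
transitivity (\int[pushforward lebesgue_measure
    (-%R : _ -> measurableTypeR R)]_(x in A)
    (normal_pdf 0 1 x)%:E)%E.
  rewrite ge0_integral_pushforward//=.
  - apply: eq_integral => x _; rewrite !normal_pdfE//= /normal_fun !subr0.
    by rewrite /= sqrrN.
  - exact: measurable_funS mf.
  - by move=> x _; rewrite lee_fin normal_pdf_ge0.
by apply: eq_measure_integral => B mB _; exact: lebesgue_measureN.
Qed.

Lemma std_normal_law_eq n d (T : measurableType d) (P : probability T R)
    d' (T' : measurableType d') (P' : probability T' R)
    (Z : {RV P >-> 'rV[R]_n}) (Z' : {RV P' >-> 'rV[R]_n}) :
  is_std_normal Z -> is_std_normal Z' -> same_law P P' Z Z'.
Proof.
move=> NZ NZ' B mB.
apply: (@rV_measure_eq R n (distribution P Z) (distribution P' Z')) => // A mA.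
by have := NZ A mA; rewrite -(NZ' A mA).
Qed.

Lemma std_normal_lawN n d (T : measurableType d) (P : probability T R)
    (Z : {RV P >-> 'rV[R]_n}) :
  is_std_normal Z -> same_law P P Z (fun w => - Z w).
Proof.
move=> NZ; have mNZ := measurable_fun_oppmx (measurable_funPT Z).
pose NZf : {RV P >-> 'rV[R]_n} := HB.pack (fun w => - Z w)
  (isMeasurableFun.Build _ _ _ _ _ mNZ).
apply: (@std_normal_law_eq _ _ _ _ _ _ _ Z NZf) => // A mA.
transitivity (\prod_(i < n) normal_prob 0 1 (-%R @^-1` A i))%E.
  rewrite -NZ.
    by congr (P _); apply/seteqP; split=> w wA i; have := wA i; rewrite /= mxE.
  by move=> i; rewrite -[X in measurable X]setTI; exact: oppr_measurable.
by apply: eq_bigr => i _; rewrite normal_prob01N.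
Qed.

(** The two roots of [Delta] coincide by [psd_sqrt_unique], so both laws are images of the standard
    normal law under one linear map. *)
Lemma normal_law_eq n d (T : measurableType d) (P : probability T R)
    d' (T' : measurableType d') (P' : probability T' R) (Delta : 'M[R]_n)
    (N : {RV P >-> 'rV[R]_n}) (N' : {RV P' >-> 'rV[R]_n}) :
  is_normal N Delta -> is_normal N' Delta -> same_law P P' N N'.
Proof.
move=> [Q [e [U [PU [Z [Qpsd QD NZ NE]]]]]].
move=> [Q' [e' [U' [PU' [Z' [Qpsd' QD' NZ' NE']]]]]].
move=> B mB; rewrite NE// NE'//.
rewrite (psd_sqrt_unique Qpsd Qpsd') ?QD ?QD'//.
have mBQ : measurable ((fun v => v *m Q') @^-1` B).
  rewrite -[X in measurable X]setTI.
  by apply: (measurable_fun_mulmx Q' (@measurable_id _ _ _)).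
exact: (std_normal_law_eq NZ NZ' mBQ).
Qed.

(** Reflection commutes with multiplication by [Q], which reduces the claim to the standard normal
    law. *)
Lemma normal_lawN n d (T : measurableType d) (P : probability T R)
    (Delta : 'M[R]_n) (N : {RV P >-> 'rV[R]_n}) :
  is_normal N Delta -> same_law P P N (fun w => - N w).
Proof.
move=> [Q [e [U [PU [Z [Qpsd QD NZ NE]]]]]] B mB.
have mNB : measurable (-%R @^-1` B : set 'rV[R]_n).
  rewrite -[X in measurable X]setTI.
  by apply: (measurable_fun_oppmx (@measurable_id _ _ _)).
have -> : (fun w => - N w) @^-1` B = N @^-1` (-%R @^-1` B) by [].
rewrite NE// NE//.
have mBQ : measurable ((fun v => v *m Q) @^-1` B).
  rewrite -[X in measurable X]setTI.
  by apply: (measurable_fun_mulmx Q (@measurable_id _ _ _)).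
have := std_normal_lawN NZ mBQ; rewrite /preimage /= => ->.
by congr (PU _); apply/funext => w /=; rewrite mulNmx.
Qed.

End normal_law.

(** * Single crossing of the GIG densities *)

Section single_crossing.
Context d (T : measurableType d) (R : realType).
Local Open Scope ereal_scope.

(** Restricting the measures and [f] to [D] turns the comparison on subsets of [D] into one on all
    measurable sets. *)
Lemma ge0_le_measure_integral_on (m1 m2 : {measure set T -> \bar R})
    (D : set T) (f : T -> \bar R) : measurable D ->
  (forall A, measurable A -> A `<=` D -> m1 A <= m2 A) ->
  (forall x, D x -> 0 <= f x) -> measurable_fun D f ->
  \int[m1]_(x in D) f x <= \int[m2]_(x in D) f x.
Proof.
move=> mD m12 f0 mf.
have restrE (m : {measure set T -> \bar R}) :
    \int[m]_(x in D) f x = \int[mrestr m mD]_(x in D) (f \_ D) x.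
  transitivity (\int[mrestr m mD]_(x in D) f x).
    by apply: eq_measure_integral => A mA AD; rewrite /= /mrestr setIidl.
  by apply: eq_integral => x xD; rewrite patchE xD.
rewrite !restrE; apply: ge0_le_measure_integral => //.
- move=> S mS; apply: m12; [exact: measurableI|exact: subIsetr].
- by move=> x; rewrite patchE; case: ifPn => // /[!inE]; exact: f0.
- exact: (measurable_restrictT f mD).1.
Qed.

(* Pushing mass upwards across the level [k] increases the integral of a
   function that is above [k] on the region gaining mass and below [k] on the other. *)
Lemma single_crossing_le_integral (m1 m2 : probability T R) (D E : set T)
    (h1 h2 : T -> R) (k : R) :
  measurable D -> measurable E -> D `&` E = set0 ->
  m1 (~` (D `|` E)) = 0 -> m2 (~` (D `|` E)) = 0 ->
  (forall A, measurable A -> A `<=` D -> m1 A <= m2 A) ->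
  (forall A, measurable A -> A `<=` E -> m2 A <= m1 A) ->
  (forall x, (D `|` E) x -> (h1 x <= h2 x)%R) ->
  (forall x, D x -> (k <= h2 x)%R) -> (forall x, E x -> (h2 x <= k)%R) ->
  m1.-integrable setT (EFin \o h1) -> m2.-integrable setT (EFin \o h2) ->
  \int[m1]_x (h1 x)%:E <= \int[m2]_x (h2 x)%:E.
Proof.
move=> mD mE DE n1 n2 mD12 mE12 h12 hD hE i1 i2.
have mDE : measurable (D `|` E) by exact: measurableU.
have splitE (m : probability T R) (h : T -> R) : m (~` (D `|` E)) = 0 ->
    m.-integrable setT (EFin \o h) ->
    \int[m]_x (h x)%:E = \int[m]_(x in D) (h x)%:E + \int[m]_(x in E) (h x)%:E.
  move=> nm im; rewrite (negligible_integral (measurableC mDE) _ im nm)//.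
  rewrite setTD setCK integral_setU//; last exact/disj_set2P.
  exact: measurable_funS (measurable_int _ im).
have sub (m : probability T R) (h : T -> R) (S : set T) : measurable S ->
    m.-integrable setT (EFin \o h) -> m.-integrable S (EFin \o h).
  by move=> mS; exact: integrableS.
have kint (m : probability T R) (S : set T) : measurable S ->
    m.-integrable S (EFin \o cst k).
  by move=> mS; exact: finite_measure_integrable_cst.
have massE (m : probability T R) : m (~` (D `|` E)) = 0 -> m D + m E = 1.
  move=> nm; rewrite -measureU//.
  have := probability_setC m (measurableC mDE).
  by rewrite setCK nm sube0.
have subk (m : probability T R) (h : T -> R) (S : set T) : measurable S ->
    m.-integrable setT (EFin \o h) ->
    \int[m]_(x in S) (h x - k)%:E = \int[m]_(x in S) (h x)%:E - k%:E * m S.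
  move=> mS im; rewrite -integral_cst//.
  by rewrite -integralB_EFin//; [exact: sub|exact: kint].
have ksub (m : probability T R) (h : T -> R) (S : set T) : measurable S ->
    m.-integrable setT (EFin \o h) ->
    \int[m]_(x in S) (k - h x)%:E = k%:E * m S - \int[m]_(x in S) (h x)%:E.
  move=> mS im; rewrite -integral_cst//.
  by rewrite -integralB_EFin//; [exact: kint|exact: sub].
have mh1 S : measurable S -> measurable_fun S h1.
  move=> mS; apply: (measurable_funS measurableT) => //.
  by have := measurable_int _ i1; move/measurable_EFinP.
have mh2 S : measurable S -> measurable_fun S h2.
  move=> mS; apply: (measurable_funS measurableT) => //.
  by have := measurable_int _ i2; move/measurable_EFinP.
have mkh (h : T -> R) S : measurable_fun S h ->
    measurable_fun S (fun x => (k - h x)%:E).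
  by move=> mh; apply/measurable_EFinP/measurable_funB.
have mhk (h : T -> R) S : measurable_fun S h ->
    measurable_fun S (fun x => (h x - k)%:E).
  by move=> mh; apply/measurable_EFinP/measurable_funB.
(* Both integrands are nonnegative on [E]: the measure is changed first, then the function. *)
have leE : \int[m2]_(x in E) (k - h2 x)%:E <= \int[m1]_(x in E) (k - h1 x)%:E.
  apply: (@le_trans _ _ (\int[m1]_(x in E) (k - h2 x)%:E)).
    apply: ge0_le_measure_integral_on => //.
      by move=> x Ex; rewrite lee_fin subr_ge0 hE.
    exact/mkh/mh2.
  apply: ge0_le_integral => //.
  - by move=> x Ex; rewrite lee_fin subr_ge0 hE.
  - exact/mkh/mh2.
  - exact/mkh/mh1.
  - by move=> x Ex; rewrite lee_fin lerB// h12//; right.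
have fin (m : probability T R) (h : T -> R) S :
    measurable S -> m.-integrable setT (EFin \o h) ->
    exists r, \int[m]_(x in S) (h x)%:E = r%:E.
  move=> mS im; have /integrable_fin_num := sub m h S mS im.
  by move=> /(_ mS)/fineK <-; eexists.
have finm (m : probability T R) S : measurable S -> exists r, m S = r%:E.
  by move=> mS; exists (fine (m S)); rewrite fineK// fin_num_measure.
have leD : \int[m1]_(x in D) (h1 x - k)%:E <= \int[m2]_(x in D) (h2 x - k)%:E.
  have leD2 : \int[m1]_(x in D) (h2 x - k)%:E <= \int[m2]_(x in D) (h2 x - k)%:E.
    apply: ge0_le_measure_integral_on => //.
      by move=> x Dx; rewrite lee_fin subr_ge0 hD.
    exact/mhk/mh2.
  apply: (le_trans _ leD2); apply: le_integral => //.
  - have -> : (fun x => (h1 x - k)%:E) = (EFin \o h1) \- (EFin \o cst k) by [].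
    by apply: integrableB => //; [exact: sub|exact: kint].
  (* As [h1 x - k] may change sign on [D], integrability is required on both sides. For [h2],
     assumed integrable only under [m2], it follows from [leD2], which bounds the [m1]-integral of
     the nonnegative [h2 x - k] by a finite one. *)
  - apply/integrableP; split; first exact/mhk/mh2.
    rewrite [X in X < _](_ : _ = \int[m1]_(x in D) (h2 x - k)%:E); last first.
      by apply: eq_integral => x /[!inE] Dx; rewrite /= ger0_norm// subr_ge0 hD.
    apply: (le_lt_trans leD2); rewrite subk//.
    have [r ->] := fin m2 h2 D mD i2; have [q ->] := finm m2 D mD.
    by rewrite -EFinM -EFinB ltry.
  - by move=> x /[!inE] Dx; rewrite lee_fin lerB// h12//; left.
rewrite (splitE m1)// (splitE m2)//.
move: leE leD; rewrite !subk// !ksub//.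
move: (massE m1 n1) (massE m2 n2).
have [a ->] := fin m1 h1 D mD i1; have [b ->] := fin m1 h1 E mE i1.
have [a' ->] := fin m2 h2 D mD i2; have [b' ->] := fin m2 h2 E mE i2.
have [p ->] := finm m1 D mD; have [q ->] := finm m1 E mE.
have [p' ->] := finm m2 D mD; have [q' ->] := finm m2 E mE.
rewrite -!EFinM -!EFinB -!EFinD !lee_fin => -[pq] [pq'] H1 H2.
(* In the sum of the two inequalities [k] is multiplied by the total masses, which are both 1 and
   hence cancel. *)
have : (k * (p + q) = k * (p' + q'))%R by rewrite pq pq'.
lra.
Qed.

End single_crossing.

(** * Generalized inverse Gaussian densities and their crossing *)

Section gig.
Variable R : realType.
Implicit Types lambda delta gamma x y : R.

(** Degenerate parameters are covered as well: a divergent integral and a division by 0 both take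
    the value 0. *)
Lemma gig_const_ge0 lambda delta gamma : 0 <= gig_const lambda delta gamma.
Proof.
have RI (f : R -> R) : (forall u, 0 <= f u) ->
    0 <= Rintegral lebesgue_measure `]0, +oo[ f.
  by move=> f0; apply: Rintegral_ge0 => u _; exact: f0.
rewrite /gig_const; case: ifP => _; rewrite divr_ge0// ?powR_ge0//.
  by apply: RI => u; rewrite mulr_ge0// ?powR_ge0// expR_ge0.
rewrite mulr_ge0// /besselK mulr_ge0//.
by apply: RI => u; rewrite mulr_ge0// ?powR_ge0// expR_ge0.
Qed.

Lemma gig_pdf_ge0 lambda delta gamma x : 0 <= gig_pdf lambda delta gamma x.
Proof.
rewrite /gig_pdf; case: ifP => // _.
by rewrite !mulr_ge0// ?gig_const_ge0 ?powR_ge0 ?expR_ge0.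
Qed.

Lemma gig_pdf_le0 lambda delta gamma x : x <= 0 -> gig_pdf lambda delta gamma x = 0.
Proof. by rewrite /gig_pdf => x0; rewrite ltNge x0. Qed.

Lemma measurable_gig_pdf lambda delta gamma :
  measurable_fun setT (gig_pdf lambda delta gamma).
Proof.
(* On [0 < x] the inverse is a real power, to which [measurable_powR] applies. *)
rewrite (_ : gig_pdf _ _ _ = fun x => if 0 < x then
    gig_const lambda delta gamma * x `^ (lambda - 1) *
    expR (- 2^-1 * (delta ^+ 2 * x `^ (-1) + gamma ^+ 2 * x)) else 0); last first.
  apply/funext => x; rewrite /gig_pdf; case: ifP => // x0.
  by rewrite powR_inv1// ltW.
apply: measurable_fun_ifT => //.
  exact: measurable_fun_ltr.
apply: measurable_funM.
  by apply: measurable_funM => //; exact: measurable_powR.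
apply: measurableT_comp => //; apply: measurable_funM => //.
apply: measurable_funD; last exact: measurable_funM.
by apply: measurable_funM => //; exact: measurable_powR.
Qed.

(** The ratio of the GIG density at [y] to that at [x], from which the normalizing constant has
    cancelled. *)
Definition gig_growth lambda delta gamma x y : R :=
  (y / x) `^ (lambda - 1) *
  expR (- 2^-1 * (delta ^+ 2 * (y^-1 - x^-1) + gamma ^+ 2 * (y - x))).

Lemma gig_pdf_growth lambda delta gamma x y : 0 < x -> x < y ->
  gig_pdf lambda delta gamma y =
  gig_pdf lambda delta gamma x * gig_growth lambda delta gamma x y.
Proof.
move=> x0 xy; have y0 := lt_trans x0 xy.
rewrite /gig_pdf x0 y0 /gig_growth.
have {1}-> : y = (y / x) * x by rewrite divfK// gt_eqF.
rewrite powRM ?ltW ?divr_gt0//.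
have -> : - 2^-1 * (delta ^+ 2 / y + gamma ^+ 2 * y) =
  - 2^-1 * (delta ^+ 2 / x + gamma ^+ 2 * x) +
  - 2^-1 * (delta ^+ 2 * (y^-1 - x^-1) + gamma ^+ 2 * (y - x)) by ring.
rewrite expRD; ring.
Qed.

(** For [x < y] the base [y / x] exceeds 1, [y^-1 - x^-1] is negative and [y - x] is positive; hence
    the ratio increases with [lambda] and [delta] and decreases with [gamma]. *)
Lemma gig_growth_le lambda1 lambda2 delta1 delta2 gamma1 gamma2 x y :
  lambda1 <= lambda2 -> 0 <= delta1 -> delta1 <= delta2 ->
  0 <= gamma2 -> gamma2 <= gamma1 -> 0 < x -> x < y ->
  gig_growth lambda1 delta1 gamma1 x y <= gig_growth lambda2 delta2 gamma2 x y.
Proof.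
move=> l12 d10 d12 g20 g12 x0 xy; have y0 := lt_trans x0 xy.
rewrite ler_pM ?powR_ge0 ?expR_ge0//.
  by rewrite ler_powR ?lerD2r// ler_pdivlMr// mul1r ltW.
rewrite ler_expR ler_wnM2l ?oppr_le0 ?invr_ge0// lerD//.
  rewrite ler_wnM2r ?ler_sqr ?nnegrE ?(le_trans d10)// subr_le0 lef_pV2 ?posrE//.
  exact: ltW.
by rewrite ler_wpM2r ?subr_ge0 ?(ltW xy)// ler_sqr ?nnegrE// (le_trans g20).
Qed.

(** The monotone likelihood ratio, in a product form that avoids dividing by a density that might be
    0. *)
Lemma gig_pdf_cross lambda1 lambda2 delta1 delta2 gamma1 gamma2 x y :
  lambda1 <= lambda2 -> 0 <= delta1 -> delta1 <= delta2 ->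
  0 <= gamma2 -> gamma2 <= gamma1 -> 0 < x -> x < y ->
  gig_pdf lambda1 delta1 gamma1 x <= gig_pdf lambda2 delta2 gamma2 x ->
  gig_pdf lambda1 delta1 gamma1 y <= gig_pdf lambda2 delta2 gamma2 y.
Proof.
move=> l12 d10 d12 g20 g12 x0 xy p12; rewrite !(gig_pdf_growth _ _ _ x0 xy).
rewrite ler_pM ?gig_pdf_ge0//; last exact: gig_growth_le.
by rewrite mulr_ge0 ?powR_ge0 ?expR_ge0.
Qed.

(** By [gig_pdf_cross] the points where the first density is at most the second form an up-set [D]
    of the positive half-line. If [D] is nonempty, its infimum is the level [c]. *)
Lemma gig_crossing d1 (T1 : measurableType d1) (P1 : probability T1 R)
    d2 (T2 : measurableType d2) (P2 : probability T2 R)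
    (X1 : {RV P1 >-> R}) (X2 : {RV P2 >-> R})
    lambda1 lambda2 delta1 delta2 gamma1 gamma2 :
  is_gig X1 lambda1 delta1 gamma1 -> is_gig X2 lambda2 delta2 gamma2 ->
  lambda1 <= lambda2 -> 0 <= delta1 -> delta1 <= delta2 ->
  0 <= gamma2 -> gamma2 <= gamma1 ->
  exists (D : set R) (c : R),
    [/\ measurable D, D `<=` `]0, +oo[, 0 <= c, (forall x, D x -> c <= x) &
        forall x, (`]0, +oo[ `\` D) x -> x <= c] /\
    (forall A, measurable A -> A `<=` D ->
      (distribution P1 X1 A <= distribution P2 X2 A)%E) /\
    (forall A, measurable A -> A `<=` `]0, +oo[ `\` D ->
      (distribution P2 X2 A <= distribution P1 X1 A)%E).
Proof.
move=> gX1 gX2 l12 d10 d12 g20 g12.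
pose p1 := gig_pdf lambda1 delta1 gamma1.
pose p2 := gig_pdf lambda2 delta2 gamma2.
have p1_ge0 x : 0 <= p1 x by exact: gig_pdf_ge0.
have p2_ge0 x : 0 <= p2 x by exact: gig_pdf_ge0.
have mp1 : measurable_fun setT p1 by exact: measurable_gig_pdf.
have mp2 : measurable_fun setT p2 by exact: measurable_gig_pdf.
have le12 A : measurable A -> (forall x, A x -> p1 x <= p2 x) ->
    (distribution P1 X1 A <= distribution P2 X2 A)%E.
  move=> mA pA; rewrite gX1// gX2//; apply: ge0_le_integral => //.
  - by move=> x _; rewrite lee_fin.
  - by apply/measurable_EFinP; exact: measurable_funTS.
  - by apply/measurable_EFinP; exact: measurable_funTS.
have le21 A : measurable A -> (forall x, A x -> p2 x <= p1 x) ->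
    (distribution P2 X2 A <= distribution P1 X1 A)%E.
  move=> mA pA; rewrite gX1// gX2//; apply: ge0_le_integral => //.
  - by move=> x _; rewrite lee_fin.
  - by apply/measurable_EFinP; exact: measurable_funTS.
  - by apply/measurable_EFinP; exact: measurable_funTS.
pose D := `]0, +oo[ `&` [set x | p1 x <= p2 x].
have mD : measurable D.
  apply: measurableI => //; rewrite -[X in measurable X]setTI.
  exact: (measurable_fun_ler mp1 mp2 measurableT (Y := [set true])).

have inD x : D x -> 0 < x /\ p1 x <= p2 x.
  by move=> [] /=; rewrite in_itv /= andbT.
have ninD x : 0 < x -> ~ D x -> p2 x < p1 x.
  by move=> x0 nDx; rewrite ltNge; apply/negP => px; apply: nDx; split => //=;
    rewrite in_itv /= x0.
have [D0|/set0P[a Da]] := eqVneq D set0; last first.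
  have lbD : lbound D 0 by move=> x /inD[/ltW].
  have infD : has_inf D by split; [by exists a|by exists 0].
  exists D, (inf D); split; [split|split].
  - exact: mD.
  - by move=> x [].
  - by apply: lb_le_inf => //; exists a.
  - by move=> x Dx; apply: ge_inf => //; exists 0.
  - move=> x [/=]; rewrite in_itv /= andbT => x0 nDx; rewrite leNgt; apply/negP => cx.
    have xc : 0 < x - inf D by rewrite subr_gt0.
    (* Some [y] in [D] lies below [x], and [gig_pdf_cross] carries membership from [y] up to [x]. *)
    have [y /inD[y0 py]] := inf_adherent xc infD; rewrite addrC subrK => yx.
    apply: nDx; split; first by rewrite /= in_itv /= x0.
    exact: (gig_pdf_cross l12 d10 d12 g20 g12 y0 yx).
  - by move=> A mA AD; apply: le12 => // x /AD/inD[].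
  - move=> A mA AD; apply: le21 => // x /AD[/=]; rewrite in_itv /= andbT => x0.
    by move=> /(ninD _ x0)/ltW.
(* If [p2 < p1] everywhere then the two probabilities coincide. *)
have p21 x : p2 x <= p1 x.
  have [x0|x0] := leP x 0; first by rewrite /p1 /p2 !gig_pdf_le0.
  by apply/ltW/ninD => //; rewrite D0.
exists `]0, +oo[%classic, 0; split; [split => //|split].
- by move=> x /=; rewrite in_itv /= andbT => /ltW.
- by move=> x [].
(* The inequality for the complement reverses to the one for [A], both total masses being 1. *)
- move=> A mA _; have := le21 _ (measurableC mA) (fun x _ => p21 x).
  rewrite !probability_setC//.
  by rewrite leeD2lE// leeN2.
- by move=> A mA _; exact: le21.
Qed.

Lemma gig_gt0 d (T : measurableType d) (P : probability T R) (X : {RV P >-> R})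
    lambda delta gamma :
  is_gig X lambda delta gamma -> distribution P X (~` `]0, +oo[) = 0%E.
Proof.
move=> gX; rewrite gX; last exact: measurableC.
apply: integral0_eq => x /=; rewrite in_itv /= andbT => /negP.
by rewrite -leNgt => /gig_pdf_le0 ->.
Qed.

End gig.

(** * Symmetrized mixtures *)

Section transfer.
Local Open Scope ereal_scope.
Context (R : realType) d0 (U : measurableType d0)
  d1 (T1 : measurableType d1) d2 (T2 : measurableType d2).
Variables (m1 : {measure set T1 -> \bar R}) (m2 : {measure set T2 -> \bar R}).
Variables (phi1 : T1 -> U) (phi2 : T2 -> U) (g : U -> R).
Hypotheses (mphi1 : measurable_fun setT phi1) (mphi2 : measurable_fun setT phi2).
Hypothesis mg : measurable_fun setT g.
Hypothesis phi12 :
  forall B, measurable B -> m1 (phi1 @^-1` B) = m2 (phi2 @^-1` B).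

(** Both sides are integrals of [g] against the same image measure. *)
Lemma integral_same_law : m1.-integrable setT (EFin \o (g \o phi1)) ->
  m2.-integrable setT (EFin \o (g \o phi2)) /\
  \int[m1]_x (g (phi1 x))%:E = \int[m2]_x (g (phi2 x))%:E.
Proof.
have mEg : measurable_fun setT (EFin \o g) by exact/measurable_EFinP.
have pushE (h : U -> \bar R) :
    \int[pushforward m1 phi1]_u h u = \int[pushforward m2 phi2]_u h u.
  by apply: eq_measure_integral => B mB _; exact: phi12.
move=> i1; have i2 : m2.-integrable setT (EFin \o (g \o phi2)).
  apply/integrableP; split.
    by apply: measurableT_comp => //; exact: measurableT_comp.
  move/integrableP : i1 => [_]; congr (_ < _).
  have mh : measurable_fun setT (fun u => `|(g u)%:E|) by exact: measurableT_comp.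
  have h0 : {in setT, forall u, 0 <= `|(g u)%:E|} by move=> u _; exact: abse_ge0.
  (* For the nonnegative absolute value the change of variables holds before integrability under
     [m2] is known. *)
  have := pushE (fun u => `|(g u)%:E|).
  rewrite (ge0_integral_pushforward mphi1 m1 measurableT mh h0).
  by rewrite (ge0_integral_pushforward mphi2 m2 measurableT mh h0).
split=> //.
have := pushE (EFin \o g).
rewrite (integral_pushforward mphi1 mEg i1 measurableT).
by rewrite (integral_pushforward mphi2 mEg i2 measurableT).
Qed.

End transfer.

(** The absolute value of the inner integral is at most the inner integral of the absolute value,
    which Tonelli controls. *)
Lemma integrable_fubini_G (R : realType) d1 (T1 : measurableType d1)
    d2 (T2 : measurableType d2) (m1 : {sigma_finite_measure set T1 -> \bar R})
    (m2 : {sigma_finite_measure set T2 -> \bar R}) (f : T1 * T2 -> \bar R) :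
  (m1 \x m2)%E.-integrable setT f -> m2.-integrable setT (fubini_G m1 f).
Proof.
move=> imf; have mf := measurable_int _ imf.
have maf : measurable_fun setT (abse \o f) by exact: measurableT_comp.
have mG := measurable_fubini_G imf.
apply/integrableP; split=> //.
apply: le_lt_trans ((integrable21ltyP m1 m2 mf).1 imf).
apply: ge0_le_integral => //.
- exact: measurableT_comp.
- by apply: (measurable_fun_fubini_tonelli_G (abse \o f)) => // z; exact: abse_ge0.
- move=> y _; apply: le_abse_integral => //.
  exact: (measurableT_comp mf (pair2_measurable y)).
Qed.

Lemma integral_prod_le (R : realType) d1 (T1 : measurableType d1)
    d2 (T2 : measurableType d2) (m1 m2 : probability T1 R)
    (nu : probability T2 R) (h1 h2 : T1 * T2 -> R) :
  (m1 \x nu)%E.-integrable setT (EFin \o h1) ->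
  (m2 \x nu)%E.-integrable setT (EFin \o h2) ->
  (forall y, m1.-integrable setT (EFin \o (fun x => h1 (x, y))) ->
    m2.-integrable setT (EFin \o (fun x => h2 (x, y))) ->
    (\int[m1]_x (h1 (x, y))%:E <= \int[m2]_x (h2 (x, y))%:E)%E) ->
  (\int[m1 \x nu]_z (h1 z)%:E <= \int[m2 \x nu]_z (h2 z)%:E)%E.
Proof.
move=> i1 i2 h12.
pose H (m : probability T1 R) (h : T1 * T2 -> R) y := (\int[m]_x (h (x, y))%:E)%E.
have iH (m : probability T1 R) (h : T1 * T2 -> R) :
    (m \x nu)%E.-integrable setT (EFin \o h) ->
    nu.-integrable setT (H m h) /\ (\int[nu]_y H m h y = \int[m \x nu]_z (h z)%:E)%E.
  move=> im; split; first exact: (integrable_fubini_G im).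
  exact: (integral21_prod_meas1 im).
have [iH1 <-] := iH _ _ i1; have [iH2 <-] := iH _ _ i2.
(* Sections are integrable only for almost every [y]; the exceptional null set [N] is removed before
   the outer integrals are compared. *)
have [N [mN N0 subN]] : {ae nu, forall y, (H m1 h1 y <= H m2 h2 y)%E}.
  have := ae_integrable2 i2; have := ae_integrable2 i1.
  by apply: filterS2 => y ? ?; exact: h12.
rewrite (negligible_integral mN measurableT iH1 N0).
rewrite (negligible_integral mN measurableT iH2 N0).
apply: le_integral.
- exact: measurableD.
- by apply: (integrableS measurableT) => //; exact: measurableD.
- by apply: (integrableS measurableT) => //; exact: measurableD.
- move=> y /[!inE] -[_ nNy]; apply: contrapT => Hy; exact/nNy/subN.
Qed.

(** * Mixtures as images of product measures, and their symmetrization *)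

Section gh.
Variables (R : realType) (n : nat).

Definition gh_map (mu b : 'rV[R]_n) (z : R * 'rV[R]_n) : 'rV[R]_n :=
  mu + z.1 *: b + Num.sqrt z.1 *: z.2.

Lemma measurable_gh_map mu b : measurable_fun setT (gh_map mu b).
Proof.
apply: measurable_fun_rV => i.
rewrite (_ : (fun z => _) = fun z : R * 'rV[R]_n =>
  mu ord0 i + z.1 * b ord0 i + Num.sqrt z.1 * z.2 ord0 i); last first.
  by apply/funext => z; rewrite !mxE.
apply: measurable_funD.
  by apply: measurable_funD => //; apply: measurable_funM.
apply: measurable_funM.
  apply: (measurableT_comp (f := @Num.sqrt R)) => //.
  by apply: continuous_measurable_fun; exact: sqrt_continuous.
exact: (measurableT_comp (measurable_rV_coord i)).
Qed.

(** Independence makes the joint law of [(X, N)] a product measure. The parameter [nu] allows both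
    mixtures to be written with one and the same normal law. *)
Lemma gh_expectation d (T : measurableType d) (P : probability T R)
    (S : {RV P >-> 'rV[R]_n}) d' (T' : measurableType d') (P' : probability T' R)
    (X : {RV P' >-> R}) (N : {RV P' >-> 'rV[R]_n}) (nu : probability 'rV[R]_n R)
    (mu b : 'rV[R]_n) (f : 'rV[R]_n -> R) :
  independent_RV X N -> (forall B, measurable B -> distribution P' N B = nu B) ->
  same_law P P' S (fun w => mu + X w *: b + Num.sqrt (X w) *: N w) ->
  measurable_fun setT f ->
  P.-integrable setT (EFin \o (f \o S)) ->
  (distribution P' X \x nu)%E.-integrable setT (EFin \o (f \o gh_map mu b)) /\
  ('E_P[f \o S] = \int[distribution P' X \x nu]_z (f (gh_map mu b z))%:E)%E.
Proof.
move=> indep nuE lawS mf iS; rewrite expectation.unlock.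
apply: (@integral_same_law R _ _ _ _ _ _ P (distribution P' X \x nu)%E
  S (gh_map mu b) f) => //; first exact: measurable_gh_map.
move=> B mB; apply: (etrans (lawS B mB)).
pose W w := (X w, N w).
have mW : measurable_fun setT W by exact: measurable_fun_pair.
have mG : measurable (gh_map mu b @^-1` B).
  by rewrite -[X in measurable X]setTI; exact: measurable_gh_map.
apply/esym; apply: (@product_measure_unique _ _ _ _ _ (distribution P' X) nu
  (pushforward P' W)) => // C D mC mD.
apply: (etrans (indep C D mC mD)); congr (_ * _)%E; exact: nuE.
Qed.

Lemma prod_measureN (m : probability R R) (nu : probability 'rV[R]_n R) B :
  (forall B : set 'rV[R]_n, measurable B -> nu (-%R @^-1` B) = nu B) -> measurable B ->
  (m \x nu)%E ((fun z : R * 'rV[R]_n => (z.1, - z.2)) @^-1` B) = (m \x nu)%E B.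
Proof.
move=> nuN mB.
have ms : measurable_fun setT (fun z : R * 'rV[R]_n => (z.1, - z.2)).
  by apply: measurable_fun_pair => //; exact: measurable_fun_oppmx.
apply/esym; apply: (@product_measure_unique _ _ _ _ _ m nu
  (pushforward (m \x nu)%E (fun z : R * 'rV[R]_n => (z.1, - z.2)))) => // C D mC mD.
have mND : measurable (-%R @^-1` D : set 'rV[R]_n).
  rewrite -[X in measurable X]setTI.
  exact: (measurable_fun_oppmx (@measurable_id _ _ _)).
transitivity ((m \x nu) (C `*` (-%R @^-1` D : set 'rV[R]_n)))%E => //.
by rewrite product_measure1E//; congr (_ * _)%E; exact: nuN.
Qed.

(** The function phi of the overview, with location and drift as parameters. *)
Definition sym_fun (f : 'rV[R]_n -> R) (mu b : 'rV[R]_n) (z : R * 'rV[R]_n) : R :=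
  (f (gh_map mu b z) + f (gh_map mu b (z.1, - z.2))) / 2.

(** The map [s] reflecting the second component preserves the product measure, so the two halves of
    [sym_fun] have equal integrals. *)
Lemma integral_sym_fun (m : probability R R) (nu : probability 'rV[R]_n R)
    (mu b : 'rV[R]_n) (f : 'rV[R]_n -> R) :
  (forall B : set 'rV[R]_n, measurable B -> nu (-%R @^-1` B) = nu B) ->
  measurable_fun setT f ->
  (m \x nu)%E.-integrable setT (EFin \o (f \o gh_map mu b)) ->
  (m \x nu)%E.-integrable setT (EFin \o sym_fun f mu b) /\
  (\int[m \x nu]_z (f (gh_map mu b z))%:E = \int[m \x nu]_z (sym_fun f mu b z)%:E)%E.
Proof.
move=> nuN mf iG.
pose s (z : R * 'rV[R]_n) := (z.1, - z.2).
have ms : measurable_fun setT s.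
  by apply: measurable_fun_pair => //; exact: measurable_fun_oppmx.
have mG : measurable_fun setT (f \o gh_map mu b).
  by apply: measurableT_comp => //; exact: measurable_gh_map.
have [] := @integral_same_law R _ _ _ _ _ _ (m \x nu)%E (m \x nu)%E id s
  (f \o gh_map mu b) (@measurable_id _ _ _) ms mG _ iG.
  by move=> B mB; exact: (esym (prod_measureN m nuN mB)).
rewrite /= => iGs GsE.
have symE : EFin \o sym_fun f mu b =
    (fun z => 2^-1%:E * ((EFin \o (f \o gh_map mu b)) \+
                          (EFin \o ((f \o gh_map mu b) \o s))) z)%E.
  by apply/funext => z; rewrite /= -EFinD -EFinM mulrC.
have iD := integrableD measurableT iG iGs.
split; first by rewrite symE; exact: integrableZl.
rewrite [RHS](_ : _ = \int[m \x nu]_z (EFin \o sym_fun f mu b) z)%E// symE.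
rewrite integralZl// integralD//= -GsE.
have := integrable_fin_num measurableT iG.
move=> /fineK <-; rewrite -EFinD -EFinM; congr (_%:E); lra.
Qed.

End gh.

(** * Monotonicity of the symmetrized function *)

Section sym_fun_theory.
Variables (R : realType) (n : nat) (f : 'rV[R]_n -> R).
Hypothesis f_mono : forall u v, vec_le u v -> f u <= f v.
Hypothesis f_conv : convex_function [set: 'rV[R]_n] f.

(** The two inner points are convex combinations of the two outer ones with exchanged weights, so
    the weights disappear when the convexity bounds are added. *)
Lemma convex_sym_le (a v : 'rV[R]_n) (s r : R) : 0 <= s -> s <= r ->
  f (a + s *: v) + f (a - s *: v) <= f (a + r *: v) + f (a - r *: v).
Proof.
move=> s0 sr; have [r0|r0] := eqVneq r 0.
  by rewrite (_ : s = r)//; lra.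
have {}r0 : 0 < r by rewrite lt_neqAle eq_sym r0 (le_trans s0).
(* The solution of [t * r - (1 - t) * r = s]. *)
pose t := (1 + s / r) / 2.
have sr1 : s / r <= 1 by rewrite ler_pdivrMr// mul1r.
have sr0 : 0 <= s / r by rewrite divr_ge0// ltW.
have t0 : 0 <= t by rewrite /t; lra.
have t1 : t <= 1 by rewrite /t; lra.
have E1 : a + s *: v = t *: (a + r *: v) + (1 - t) *: (a - r *: v).
  by apply/rowP => i; rewrite !mxE /t; field; rewrite gt_eqF.
have E2 : a - s *: v = t *: (a - r *: v) + (1 - t) *: (a + r *: v).
  by apply/rowP => i; rewrite !mxE /t; field; rewrite gt_eqF.
rewrite E1 E2.
have := convex_functionE f_conv (a + r *: v) (a - r *: v) t0 t1.
have := convex_functionE f_conv (a - r *: v) (a + r *: v) t0 t1.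
lra.
Qed.

(** The drift is first raised from [x *: b] to [y *: b] by monotonicity of [f]; the spread then
    grows by [convex_sym_le]. Symmetrizing is what handles a vector [v] of arbitrary sign. *)
Lemma sym_fun_mono (mu b v : 'rV[R]_n) (x y : R) : vec_le 0 b ->
  0 <= x -> x <= y -> sym_fun f mu b (x, v) <= sym_fun f mu b (y, v).
Proof.
move=> b0 x0 xy; rewrite /sym_fun ler_pM2r// /gh_map /= !scalerN.
apply: (le_trans _ (convex_sym_le (mu + y *: b) v (sqrtr_ge0 x) _)); last first.
  by rewrite ler_wsqrtr.
have bi i : 0 <= b ord0 i by have := b0 i; rewrite mxE.
by apply: lerD; apply: f_mono => i; rewrite !mxE !lerD2r lerD2l ler_wpM2r.
Qed.

Lemma sym_fun_le (mu1 mu2 b1 b2 : 'rV[R]_n) z : vec_le mu1 mu2 -> vec_le b1 b2 ->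
  0 <= z.1 -> sym_fun f mu1 b1 z <= sym_fun f mu2 b2 z.
Proof.
move=> mu12 b12 z0; rewrite /sym_fun ler_pM2r// /gh_map /=.
by apply: lerD; apply: f_mono => i; rewrite !mxE !lerD2r lerD// ler_wpM2l.
Qed.

End sym_fun_theory.

Lemma vec_leM (R : realType) n (M : 'M[R]_n) (u v : 'rV[R]_n) :
  (forall k l, 0 <= M k l) -> vec_le u v -> vec_le (u *m M) (v *m M).
Proof.
by move=> M0 uv i; rewrite !mxE; apply: ler_sum => k _; rewrite ler_wpM2r.
Qed.

Lemma quad_form_le (R : realType) n (M : 'M[R]_n) (u v : 'rV[R]_n) :
  (forall k l, 0 <= M k l) -> vec_le 0 u -> vec_le u v ->
  quad_form M u <= quad_form M v.
Proof.
move=> M0 u0 uv; rewrite /quad_form !mxE; apply: ler_sum => k _.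
have nng i : 0 <= u ord0 i by have := u0 i; rewrite mxE.
have := vec_leM M0 u0 k; rewrite mul0mx mxE => uM0.
by rewrite [u^T _ _]mxE [v^T _ _]mxE ler_pM// ?vec_leM//; exact: uv.
Qed.

Theorem theorem4p2 (R : realType) (d : nat)
  (disp1 disp2 : measure_display)
  (T1 : measurableType disp1) (T2 : measurableType disp2)
  (P1 : probability T1 R) (P2 : probability T2 R)
  (S1 : {RV P1 >-> 'rV[R]_d}) (S2 : {RV P2 >-> 'rV[R]_d})
  (lambda1 lambda2 alpha1 alpha2 delta1 delta2 : R)
  (beta1 beta2 mu1 mu2 : 'rV[R]_d) (Delta1 Delta2 : 'M[R]_d)
  (hS1 : is_GH S1 lambda1 alpha1 beta1 delta1 mu1 Delta1)
  (hS2 : is_GH S2 lambda2 alpha2 beta2 delta2 mu2 Delta2)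
  (hlambda : lambda1 <= lambda2) (hdelta : delta1 <= delta2)
  (halpha : alpha2 <= alpha1) (hmu : vec_le mu1 mu2)
  (hcases :
     [\/ [/\ vec_le 0 beta1, vec_le beta1 beta2, Delta1 = 1%:M &
             Delta2 = 1%:M],
         [/\ beta1 = 0, beta2 = 0 & psd_le Delta1 Delta2] |
         [/\ vec_le 0 beta1, vec_le beta1 beta2, psd_le Delta1 Delta2 &
             forall k l, 0 <= Delta1 k l /\ Delta1 k l <= Delta2 k l]]) :
  icx_le S1 S2.
Proof.
have [[psd1 det1 d10 a10 qa1]
  [e1 [U1 [PU1 [X1 [N1 [gX1 nN1 ind1 law1]]]]]]] := hS1.
have [[psd2 det2 d20 a20 qa2]
  [e2 [U2 [PU2 [X2 [N2 [gX2 nN2 ind2 law2]]]]]]] := hS2.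
(* The root comes with the normal law of [N1]. *)
have sqrtD1 : exists2 Q, is_psd Q & Q *m Q = Delta1.
  by case: nN1 => [Q [? [? [? [? [? ? _ _]]]]]]; exists Q.
(* The common content of the three cases. With psd comparison, determinant 1 gives equality of the
   matrices; ordered drifts and quadratic forms come from nonnegative entries, or are trivial for
   zero [beta1] and [beta2]. *)
have [DE b20 b12 q12] : [/\ Delta1 = Delta2, vec_le 0 (beta2 *m Delta2),
    vec_le (beta1 *m Delta1) (beta2 *m Delta2) &
    quad_form Delta1 beta1 <= quad_form Delta2 beta2].
  have nonneg (M : 'M[R]_d) : (forall k l, 0 <= M k l) -> vec_le 0 beta1 ->
      vec_le beta1 beta2 -> [/\ vec_le 0 (beta2 *m M),
        vec_le (beta1 *m M) (beta2 *m M) & quad_form M beta1 <= quad_form M beta2].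
    move=> M0 b0 b12; split; [|exact: vec_leM|exact: quad_form_le].
    rewrite -(mul0mx _ M); apply: vec_leM => // i.
    exact: le_trans (b0 i) (b12 i).
  case: hcases => [[b0 b12 -> ->]|[-> -> le12]|[b0 b12 le12 M0]].
  - have [] := nonneg 1%:M _ b0 b12; last by split.
    by move=> k l; rewrite mxE ler0n.
  - rewrite !mul0mx (psd_le_det1_eq sqrtD1 le12 det1 det2) !quad_form0.
    by split.
  - have E := psd_le_det1_eq sqrtD1 le12 det1 det2; rewrite -E.
    have [] := nonneg Delta1 _ b0 b12; last by split.
    by move=> k l; case: (M0 k l).
subst Delta2; move: gX1 gX2.
set gamma1 := Num.sqrt _; set gamma2 := Num.sqrt _ => gX1 gX2.
have g20 : 0 <= gamma2 by exact: sqrtr_ge0.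
(* Passing from the first law to the second, [alpha ^+ 2] decreases and the quadratic form
   subtracted from it increases. *)
have g21 : gamma2 <= gamma1.
  rewrite ler_wsqrtr// lerB// ler_sqr// nnegrE ltW//.
have [D [c [[mD Dpos c0 Dc Ec] [le12 le21]]]] :=
  gig_crossing gX1 gX2 hlambda d10 hdelta g20 g21.
move=> f f_mono f_conv iS1 iS2.
have mf := convex_mono_measurable f_mono f_conv.
pose nu : probability 'rV[R]_d R := distribution PU1 N1.
have nuN (B : set 'rV[R]_d) : measurable B -> nu (-%R @^-1` B) = nu B.
  by move=> mB; have := normal_lawN nN1 mB.
have nuE B : measurable B -> distribution PU2 N2 B = nu B.
  by move=> mB; exact: (normal_law_eq nN2 nN1 mB).
have [iG1 ->] := gh_expectation ind1 (fun _ _ => erefl) law1 mf iS1.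
have [iG2 ->] := gh_expectation ind2 nuE law2 mf iS2.
have [iY1 ->] := integral_sym_fun nuN mf iG1.
have [iY2 ->] := integral_sym_fun nuN mf iG2.
apply: integral_prod_le => // v iv1 iv2.
have DUE : D `|` (`]0, +oo[ `\` D) = `]0%R, +oo[%classic by rewrite setDUK.
(* The level [k] uses the second location and drift, since it is compared with the second integrand;
   [sym_fun_le] absorbs the change from the first ones. *)
apply: (single_crossing_le_integral (D := D) (E := `]0, +oo[ `\` D)
  (k := sym_fun f mu2 (beta2 *m Delta1) (c, v))) => //.
- exact: measurableD.
- by rewrite setDIK.
- by rewrite DUE; exact: gig_gt0 gX1.
- by rewrite DUE; exact: gig_gt0 gX2.
- rewrite DUE => x /=; rewrite in_itv /= andbT => x0.
  by apply: sym_fun_le => //=; exact: ltW.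
- by move=> x Dx; apply: sym_fun_mono => //; exact: Dc.
- move=> x Ex; apply: sym_fun_mono => //; last exact: Ec.
  by case: Ex => /=; rewrite in_itv /= andbT => /ltW.
Qed.
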